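(* Being a Choquet space is backwards inheritable. That is, for every topological space $(X,\tau)$, if there exists a dense subset $D\subseteq X$ such that $(D,\tau|_{D})$ is a Choquet space, then $(X,\tau)$ is a Choquet space.
   Context: A property $\Phi$ for topological subspaces is called backwards inheritable if for all topological spaces $(X,\tau)$: whenever a dense subset $D\subseteq X$ exists such that $(D,\tau|_{D})$ (subspace topology) satisfies $\Phi$, then $(X,\tau)$ satisfies $\Phi$. For a topological space $X$, the Choquet game $\mathcal{G}_{X}$ is played by two players, I and II, who alternate choosing non-empty open subsets of $X$: Player I plays $U_{0}$, Player II plays $V_{0}$, Player I plays $U_{1}$, Player II plays $V_{1}$, and so on. A run is valid if and only if $U_{0}\supseteq V_{0}\supseteq U_{1}\supseteq V_{1}\supseteq\cdots$. Player I wins a run exactly if $\bigcap_{n\in\mathbb{N}_{0}}U_{n}\,(=\bigcap_{n\in\mathbb{N}_{0}}V_{n})=\emptyset$; otherwise Player II wins. The space $X$ is called a Choquet space if Player II has a winning strategy in $\mathcal{G}_{X}$. *)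

(* Defs.v *)
From HB Require Import structures.
From mathcomp Require Import all_boot all_order all_algebra.
From mathcomp Require Import all_classical all_reals all_analysis.

Set Implicit Arguments.
Unset Strict Implicit.
Unset Printing Implicit Defensive.

Local Open Scope classical_set_scope.

(* The type associated with a set D of X carries the library's subspace
   topology (the initial topology of the inclusion, subtype_topology.v). *)
Definition backwards_inheritable (Phi : topologicalType -> Prop) : Prop :=
  forall X : topologicalType,
    (exists D : set X, dense D /\ Phi (set_type D)) -> Phi X.

Section ChoquetGame.
Variable X : topologicalType.
Implicit Types U V : nat -> set X.

Definition legal_move (A B : set X) : Prop :=
  [/\ open B, B !=set0 & B `<=` A].

(* U n and V n are the n-th moves of players I and II; the opening move U 0
   is only constrained to be a non-empty open set. *)
Definition legal_I U V (n : nat) : Prop :=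
  legal_move (if n is m.+1 then V m else setT) (U n).

Definition legal_II U V (n : nat) : Prop := legal_move (U n) (V n).

Definition valid_run U V : Prop :=
  forall n, legal_I U V n /\ legal_II U V n.

Definition II_wins U V : Prop := \bigcap_n U n !=set0.

(* A strategy for II maps the completed rounds (U 0, V 0), ..., (U (n-1), V (n-1))
   and the current move U n of I to the answer V n. *)
Definition strategy_II : Type := seq (set X * set X) -> set X -> set X.

Definition follows_II (s : strategy_II) U V (n : nat) : Prop :=
  V n = s (mkseq (fun i => (U i, V i)) n) (U n).

(* The first clause makes the strategy answer legally at every reachable
   position, i.e. as long as I has respected the rules. Without it, a strategy
   prescribing illegal answers would win vacuously. *)
Definition winning_II (s : strategy_II) : Prop :=
  (forall U V n,
      (forall i, (i <= n)%N -> legal_I U V i /\ follows_II s U V i) ->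
      legal_II U V n) /\
  (forall U V,
      valid_run U V -> (forall n, follows_II s U V n) -> II_wins U V).

End ChoquetGame.

Definition choquet_space (X : topologicalType) : Prop :=
  exists s : strategy_II X, winning_II s.

(* Main.v *)
(* Player II answers U in X by U `&` W, where W is an open set of X whose trace
   on D is the answer of the strategy on D to the trace of U. The trace of II's
   answer is then exactly that answer, so taking traces turns a play in X into
   a play in D, and a point of D won there lies in the intersection in X. *)

Require Import Defs.
From mathcomp Require Import all_boot all_order all_algebra.
From mathcomp Require Import all_classical all_reals all_analysis.

Set Implicit Arguments.
Unset Strict Implicit.
Unset Printing Implicit Defensive.

Local Open Scope classical_set_scope.

(** The legality clause of [winning_II] speaks only of runs whose [n]-th answer is already that of
    the strategy. Overwriting [V n] by this answer gives such a run, and neither the history before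
    [n] nor the legality of I's moves up to [n] depends on [V n]. *)
Lemma winning_II_legal_move (X : topologicalType) (s : strategy_II X)
    (U V : nat -> set X) (n : nat) :
  winning_II s ->
  (forall i, (i < n)%N -> legal_I U V i /\ follows_II s U V i) ->
  legal_I U V n ->
  legal_move (U n) (s (mkseq (fun i => (U i, V i)) n) (U n)).
Proof.
move=> [s_legal _] past In.
pose V' i := if i == n then s (mkseq (fun i => (U i, V i)) n) (U n) else V i.
have V'E i : (i < n)%N -> V' i = V i by move=> ltin; rewrite /V' ltn_eqF.
have histE i : (i <= n)%N ->
    mkseq (fun i => (U i, V' i)) i = mkseq (fun i => (U i, V i)) i.
  move=> lein; apply/eq_in_map => j; rewrite mem_iota add0n => /andP[_ ltji].
  by rewrite V'E// (leq_trans ltji).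
have IE i : (i <= n)%N -> legal_I U V' i = legal_I U V i.
  by case: i => [//|i] lein; rewrite /legal_I V'E.
suff : legal_II U V' n by rewrite /legal_II /V' eqxx.
apply: s_legal => i lein; rewrite IE// /follows_II histE//.
move: lein; rewrite leq_eqVlt => /predU1P[->|ltin].
  by split=> //; rewrite /V' eqxx.
by rewrite V'E//; exact: past.
Qed.

Section LiftStrategy.
Variables (X : topologicalType) (D : set X).
Implicit Types (A W : set X) (U V : nat -> set X) (s : strategy_II (set_type D)).

Let trace A : set (set_type D) := set_val @^-1` A.

(** A non-empty open set meets [D], so its trace stays non-empty. *)
Lemma dense_legal_trace A B :
  dense D -> legal_move A B -> legal_move (trace A) (trace B).
Proof.
move=> dD [oB B0 BA]; split; first by exists B.
- have [x [Bx Dx]] := dD _ B0 oB.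
  by exists (exist _ x (mem_set Dx)).
- by move=> x; exact: BA.
Qed.

(** The default [set0] of [xget] arises only if the answer of [s] is not open in [D], hence never
    when that answer is legal. *)
Definition lift_strategy s : strategy_II X := fun h A =>
  A `&` xget set0 [set W | open W /\
    trace W = s [seq (trace p.1, trace p.2) | p <- h] (trace A)].

Lemma lift_strategy_legal s h A :
  let B := s [seq (trace p.1, trace p.2) | p <- h] (trace A) in
  open A -> legal_move (trace A) B ->
  legal_move A (lift_strategy s h A) /\ trace (lift_strategy s h A) = B.
Proof.
move=> B oA [[W oW WB] B0 BA].
have : exists W, open W /\ trace W = B by exists W.
move=> /(xgetPex set0).
rewrite /lift_strategy -/B; set W' := xget _ _ => -[oW' trW'].
(* Intersecting with [A] keeps the trace, since [B] already lies in the trace of [A]. *)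
have trE : trace (A `&` W') = B.
  rewrite -trW'; apply/seteqP; split=> [x []//|x W'x]; split=> //.
  by apply: BA; rewrite -trW'.
split=> //; split; [exact: openI| |exact: subIsetl].
by case: B0 => x; rewrite -trE => ?; exists (set_val x).
Qed.

(** The two claims go together by strong induction: the lifted answer is legal with the right trace
    once [s] answers legally in [D], and this requires the traces to have followed [s] in all
    earlier rounds. *)
Lemma lift_strategy_play s U V n :
  dense D -> winning_II s ->
  (forall i, (i <= n)%N -> legal_I U V i /\ follows_II (lift_strategy s) U V i) ->
  legal_II U V n /\ follows_II s (trace \o U) (trace \o V) n.
Proof.
move=> dD sW; elim/ltn_ind: n => n IH play.
have I_trace i : (i <= n)%N -> legal_I (trace \o U) (trace \o V) i.
  (* In round 0 the bound is [setT], whose trace is [setT] by conversion. *)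
  by move=> /play[Ii _]; case: i Ii => [|i] /(dense_legal_trace dD).
have [[oU _ _] Vn] := play n (leqnn n).
have past i : (i < n)%N ->
    legal_I (trace \o U) (trace \o V) i /\
    follows_II s (trace \o U) (trace \o V) i.
  move=> ltin; split; first by apply: I_trace; exact: ltnW.
  by apply: (IH i ltin _).2 => j leji; apply: play; exact: leq_trans (ltnW ltin).
have := winning_II_legal_move sW past (I_trace n (leqnn n)).
have -> : mkseq (fun i => ((trace \o U) i, (trace \o V) i)) n =
    [seq (trace p.1, trace p.2) | p <- mkseq (fun i => (U i, V i)) n].
  by rewrite /mkseq -map_comp.
move=> /(lift_strategy_legal oU); rewrite -Vn => -[IIn trVn].
by split=> //; rewrite /follows_II /= trVn /mkseq -map_comp.
Qed.

Lemma lift_strategy_winning s :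
  dense D -> winning_II s -> winning_II (lift_strategy s).
Proof.
move=> dD sW; split=> [U V n play|U V run fol].
  exact: (lift_strategy_play dD sW play).1.
have fol_trace n : follows_II s (trace \o U) (trace \o V) n.
  by apply: (lift_strategy_play dD sW _).2 => i _; split; [exact: (run i).1|].
(* Legality of both players' moves passes to the traces directly from the run in [X]. *)
have run_trace : valid_run (trace \o U) (trace \o V).
  move=> n; have [In IIn] := run n; split; last exact: dense_legal_trace.
  by case: n In {IIn} => [|n] /(dense_legal_trace dD).
have [x Ux] := sW.2 _ _ run_trace fol_trace.
by exists (set_val x) => n _; exact: Ux.
Qed.

End LiftStrategy.

Theorem lemma3p8 : backwards_inheritable choquet_space.
Proof.
move=> X [D [dD [s sW]]]; exists (lift_strategy s).
exact: lift_strategy_winning.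
Qed.
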